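(* The function $c\mapsto\beta(c)$ is continuous on $\mathbb{T}$. On the other hand, the function $c\mapsto\alpha(c)$ is upper semicontinuous on $\mathbb{T}$, and the set of points at which it is continuous is exactly $\mathcal{C}_\infty$.
   Context: $\mathbb{T}=\mathbb{R}/\mathbb{Z}$ is the torus with the doubling map $T\colon x\mapsto 2x \pmod 1$. For $c\in\mathbb{T}$, $\psi_c\colon\mathbb{T}\to[-\infty,+\infty)$ is $\psi_c(x)=2\log(|\sin(\pi(x-c))|)$, with $\log 0=-\infty$. $\mathcal{M}$ is the set of $T$-invariant Borel probability measures on $\mathbb{T}$. Set $\alpha(c)=\inf_{\mu\in\mathcal{M}}\int\psi_c\,\mathrm{d}\mu\in[-\infty,0]$, $\beta(c)=\sup_{\mu\in\mathcal{M}}\int\psi_c\,\mathrm{d}\mu$, and $\mathcal{C}_\infty=\{c\in\mathbb{T}:\alpha(c)=-\infty\}$. (Semi)continuity of $\alpha$ is with respect to the usual topology of the extended real line. *)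

(* Defs.v *)
From HB Require Import structures.
From mathcomp Require Import all_boot all_order all_algebra.
From mathcomp Require Import all_classical all_reals all_analysis.
Import Order.TTheory GRing.Theory Num.Theory.
Import numFieldNormedType.Exports.

Set Implicit Arguments.
Unset Strict Implicit.
Unset Printing Implicit Defensive.

Local Open Scope classical_set_scope.
Local Open Scope ring_scope.

(* Z as an additive subgroup of R: the predicate underlying [Num.int]. *)
Definition integers (R : realType) : zmodClosed R :=
  GRing.ZmodClosed.clone R (@Num.int_num_subdef R) _.

Definition torus (R : realType) : Type :=
  quotient_topology {ideal_quot (integers R)}.

HB.instance Definition _ (R : realType) := Topological.on (torus R).
HB.instance Definition _ (R : realType) := Pointed.on (torus R).
HB.instance Definition _ (R : realType) := Quotient.on (torus R).

(* The group law of the quotient R / Z; [GRing.Zmodule.copy] does not apply as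
   [quotient_topology] carries its own choice structure. *)
HB.instance Definition _ (R : realType) :=
  GRing.isZmodule.Build (torus R)
    (@Quotient.addqA R (integers R)) (@Quotient.addqC R (integers R))
    (@Quotient.add0q R (integers R)) (@Quotient.addNq R (integers R)).

Definition borel_torus (R : realType) := g_sigma_algebraType (@open (torus R)).

Definition doubling (R : realType) (x : torus R) : torus R := x *+ 2.

(* [lne 0 = -oo]; |sin (pi t)| is 1-periodic in t, so the value does not depend
   on the representative of x - c in R. *)
Definition psi (R : realType) (c x : torus R) : \bar R :=
  (2%:E * lne `|sin (pi * repr (x - c))|%:E)%E.

Definition invariant_measure (R : realType)
    (mu : probability (borel_torus R) R) : Prop :=
  forall A : set (borel_torus R), measurable A ->
    mu (@doubling R @^-1` A) = mu A.

Definition alpha (R : realType) (c : torus R) : \bar R :=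
  ereal_inf [set \int[mu]_x psi c x | mu in @invariant_measure R]%E.

Definition beta (R : realType) (c : torus R) : \bar R :=
  ereal_sup [set \int[mu]_x psi c x | mu in @invariant_measure R]%E.

Definition C_infty (R : realType) : set (torus R) :=
  [set c | alpha c = -oo%E].

(* Counterpart of the library's [lower_semicontinuous]. *)
Definition upper_semicontinuous (X : topologicalType) (R : realType)
    (f : X -> \bar R) : Prop :=
  forall x a, (f x < a%:E)%E ->
    exists2 V, nbhs x V & forall y, V y -> (f y < a%:E)%E.

(* Main.v *)
Require Import Defs.
From HB Require Import structures.
From mathcomp Require Import all_boot all_order all_algebra.
From mathcomp Require Import all_classical all_reals all_analysis.
From mathcomp Require Import measurable_realfun ring lra.
Import Order.TTheory GRing.Theory Num.Theory.
Import numFieldNormedType.Exports.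
Set Implicit Arguments.
Unset Strict Implicit.
Unset Printing Implicit Defensive.
Local Open Scope classical_set_scope.
Local Open Scope ring_scope.

(**
  For fixed [mu] the integral of [psi c] is upper semicontinuous in [c], hence
  so is the infimum [alpha].  A periodic [c] lies in its own orbit, so
  [alpha c = -oo] there; periodic points are dense, so [alpha] is discontinuous
  wherever it exceeds [-oo].

  For [beta], write [g t = |sin (pi t)|] and lift orbits to [R] as [2 ^+ i * y].
  If the integral of [psi c] exceeds [-2 (l - e)], with [l <= ln 2], some orbit
  of length [n] has a sum of [ln g + l] at least [n e].  At a time [q] where the
  partial sums reach a record, [g (2 ^+ i * y - c) >= 2 ^- (q - i)] for all
  [i < q], because [ln g <= 0].  Among enough records two times [p < q] give
  close points, and the periodic point of period [q - p] that closes up the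
  segment follows it within a small multiple of [2 ^- (q - i)]; this is small
  relative to the distance to [c], so each [ln g] changes by at most [e].  The
  period is bounded in terms of [e] only, so this periodic orbit is still almost
  optimal for every [c'] within a distance depending on [e] only, and [beta] is
  uniformly continuous.  The condition [l <= ln 2] is available since the orbits
  [{0}] and [{1/3, 2/3}] give [beta >= ln (3/8) > - 2 ln 2].
*)

(** * Closing orbit segments that avoid the singularity *)

(** The first time at which [D] reaches a level [l * b] is a record. Since [D] rises by at most [b]
    per step, it stays below the next level at that time, so the [J + 1] levels give distinct times,
    and two of them share a colour. *)
Lemma record_pigeonhole (R : realType) (D : nat -> R) (b : R) (J n : nat)
    (col : nat -> 'I_J) :
  0 < b -> D 0%N = 0 -> (forall i, (i < n)%N -> D i.+1 <= D i + b) ->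
  J%:R * b <= D n ->
  exists p q, [/\ (p < q)%N, (q <= n)%N, col p = col q &
    forall i, (i < q)%N -> D i <= D q].
Proof.
move=> b0 D0 Db Dn.
have ex (l : 'I_J.+1) : exists m, (l%:R * b <= D m) && (m <= n)%N.
  exists n; rewrite leqnn andbT (le_trans _ Dn)// ler_wpM2r ?(ltW b0)//.
  by rewrite ler_nat -ltnS ltn_ord.
pose q l := ex_minn (ex l).
have qP (l : 'I_J.+1) : [/\ l%:R * b <= D (q l), (q l <= n)%N &
    forall i, (i < q l)%N -> D i < l%:R * b].
  rewrite /q; case: ex_minnP => m /andP[Dm mn] min; split => // i im.
  rewrite ltNge; apply/negP => h; have := min i.
  by rewrite h (ltnW (leq_trans im mn)) /= leqNgt im => /(_ isT).
have qlt (l l' : 'I_J.+1) : (l < l')%N -> (q l < q l')%N.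
  move=> ll'; have [Dl qln minl] := qP l; have [Dl' ql'n minl'] := qP l'.
  have ll'R : l%:R * b + b <= l'%:R * b.
    by rewrite -[X in _ + X]mul1r -mulrDl natr1 ler_wpM2r ?(ltW b0)// ler_nat.
  have Dll' : D (q l) < l'%:R * b.
    case E : (q l) => [|m].
      by rewrite D0 mulr_gt0// ltr0n (leq_ltn_trans _ ll').
    have mq : (m < q l)%N by rewrite E.
    rewrite (le_lt_trans (Db m _)) ?(leq_trans mq)//.
    by rewrite (lt_le_trans _ ll'R)// ltrD2r minl.
  rewrite ltnNge; apply/negP; rewrite leq_eqVlt => /orP[/eqP E|h].
    by move: Dll'; rewrite -E ltNge Dl'.
  have := minl _ h; apply/negP; rewrite -leNgt (le_trans _ Dl')//.
  by rewrite (le_trans _ ll'R)// lerDl ltW.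
have /injectivePn[x [y xy e]] : ~~ injectiveb (col \o q).
  by apply/injectiveP => /leq_card; rewrite !card_ord ltnn.
wlog xy' : x y xy e / (x < y)%N.
  move=> H; have : val x != val y by [].
  rewrite neq_ltn => /orP[|] h; first exact: (H x y).
  by apply: (H y x) => //; rewrite eq_sym.
exists (q x), (q y); have [Dy qyn miny] := qP y.
split => //; first exact: qlt.
by move=> i iq; rewrite (le_trans (ltW (miny _ iq))).
Qed.

(** The solution [z] of [2 ^+ r * z = z + k]: a lift of a point fixed by the [r]-th iterate of
    doubling. *)
Definition per_pt (R : realType) (r : nat) (k : int) : R :=
  k%:~R / (2 ^+ r - 1).

Lemma per_ptE (R : realType) (r : nat) (k : int) : (0 < r)%N ->
  2 ^+ r * per_pt R r k = per_pt R r k + k%:~R.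
Proof.
move=> r0; have h : 2 ^+ r - 1 != 0 :> R.
  by rewrite subr_eq0 gt_eqF// exprn_egt1// -?lt0n// ltr1n.
rewrite /per_pt; move: (2 ^+ r : R) h => x h; field.
by [].
Qed.

(** Doubling expands, so the closing error [d] at the end of the segment shrinks geometrically
    backwards in time; the factor 2 comes from [2 ^+ r - 1 >= 2 ^+ r / 2]. *)
Lemma per_pt_closing (R : realType) (r : nat) (k : int) (u d : R) : (0 < r)%N ->
  `|2 ^+ r * u - u - k%:~R| <= d ->
  forall i, (i < r)%N ->
  `|2 ^+ i * per_pt R r k - 2 ^+ i * u| <= 2 * d * 2 ^- (r - i).
Proof.
move=> r0 hd i ir.
have h2 : 2 ^+ r - 1 >= 2 ^+ r / 2 :> R.
  by rewrite -(prednK r0) exprS; have := @exprn_ege1 R r.-1 2; lra.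
have h0 : 0 < 2 ^+ r - 1 :> R.
  by rewrite (lt_le_trans _ h2)// divr_gt0// exprn_gt0.
have -> : 2 ^+ i * per_pt R r k - 2 ^+ i * u =
    - (2 ^+ i / (2 ^+ r - 1)) * (2 ^+ r * u - u - k%:~R).
  rewrite /per_pt; move: (2 ^+ r : R) h0 => x h; field.
  by rewrite gt_eqF.
rewrite normrM normrN (@ger0_norm _ (_ / _)) ?divr_ge0 ?exprn_ge0 ?(ltW h0)//.
apply: (@le_trans _ _ (2 ^+ i / (2 ^+ r - 1) * d)).
  by apply: ler_wpM2l => //; rewrite divr_ge0 ?exprn_ge0 ?(ltW h0).
have -> : 2 * d * 2 ^- (r - i) = 2 ^+ i / (2 ^+ r / 2) * d.
  rewrite -{2}(subnK (ltnW ir)) exprD; field.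
  by rewrite !expf_neq0.
apply: ler_wpM2r; first exact: le_trans hd.
apply: ler_wpM2l; first exact: exprn_ge0.
by rewrite lef_pV2// posrE// divr_gt0// exprn_gt0.
Qed.

(** The [g] of the overview: half the distance from [exp (2 i pi t)] to 1 in the complex plane. *)
Definition chord (R : realType) (t : R) : R := `|sin (pi * t)|.

Lemma chord_ge0 (R : realType) (t : R) : 0 <= chord t.
Proof. exact: normr_ge0. Qed.

Lemma chord_le1 (R : realType) (t : R) : chord t <= 1.
Proof. exact: sin_max. Qed.

Lemma chordDint (R : realType) (t : R) (k : int) : chord (t + k%:~R) = chord t.
Proof.
have nat_case (n : nat) (s : R) : chord (s + n%:R) = chord s.
  elim: n s => [|n IH] s; first by rewrite addr0.
  by rewrite -natr1 addrA -[RHS]IH /chord mulrDr mulr1 sinDpi normrN.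
case: k => n; first exact: nat_case.
rewrite NegzE -[RHS](@nat_case n.+1) mulrNz.
by rewrite -[in RHS](subrK n.+1%:R t) nat_case.
Qed.

Lemma sin_lip (R : realType) (x y : R) : `|sin x - sin y| <= `|x - y|.
Proof.
wlog xy : x y / y <= x.
  by move=> H; case: (leP y x) => [/H//|/ltW/H]; rewrite distrC (distrC y).
have [|z _ ->] := @MVT_segment _ (@sin R) (@cos R) _ _ xy.
  by apply: continuous_subspaceT; exact: continuous_sin.
by rewrite normrM ler_piMl// cos_max.
Qed.

Lemma chord_lip (R : realType) (s t : R) :
  `|chord s - chord t| <= pi * `|s - t|.
Proof.
apply: (le_trans (ler_dist_dist _ _)); apply: (le_trans (sin_lip _ _)).
by rewrite -mulrBr normrM (ger0_norm (pi_ge0 R)).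
Qed.

(** The displacement is measured relative to [chord a] because [ln] is not uniformly continuous near
    0; [chord_lip] then gives [chord b >= expR (- e) * chord a]. *)
Lemma chord_pos_stable (R : realType) (a b e : R) : 0 < chord a ->
  pi * `|b - a| <= (1 - expR (- e)) * chord a ->
  0 < chord b /\ ln (chord a) - e <= ln (chord b).
Proof.
move=> a0 h; have h1 : expR (- e) * chord a <= chord b.
  have := le_trans (ler_norm _) (chord_lip a b); rewrite distrC; lra.
have b0 : 0 < chord b by rewrite (lt_le_trans _ h1)// mulr_gt0// expR_gt0.
split => //; move: h1; rewrite -ler_ln ?posrE ?mulr_gt0 ?expR_gt0//.
by rewrite lnM ?posrE ?expR_gt0// expRK; lra.
Qed.

(** Supplies the colours for the pigeonhole: the cell of length [1 / (J + 1)] that contains the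
    fractional part. *)
Lemma frac_cell (R : realType) (J : nat) (t : R) :
  exists c : 'I_J.+1, exists k : int,
    `|t - k%:~R - c%:R / J.+1%:R| <= J.+1%:R^-1.
Proof.
pose f := t - (Num.floor t)%:~R.
have /andP[fl fr] := floor_itv t.
have f0 : 0 <= f by rewrite subr_ge0.
have f1 : f < 1 by move: fr; rewrite intrD /f; lra.
have J0 : 0 < J.+1%:R :> R by rewrite ltr0n.
have fJ0 : 0 <= f * J.+1%:R by rewrite mulr_ge0// ltW.
have := truncn_itv fJ0; set c := Num.truncn _ => /andP[c0 c1].
have cJ : (c < J.+1)%N.
  by rewrite -(ltr_nat R) (le_lt_trans c0)// gtr_pMl.
exists (Ordinal cJ), (Num.floor t) => /=; rewrite -/f.
have -> : f - c%:R / J.+1%:R = (f * J.+1%:R - c%:R) / J.+1%:R.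
  by field; rewrite gt_eqF.
have J1 : 0 <= J.+1%:R^-1 :> R by rewrite invr_ge0 ltW.
rewrite normrM (ger0_norm J1) ler_piMl// ger0_norm ?subr_ge0//.
by move: c1; rewrite -natr1; lra.
Qed.

(** The order of quantifiers is the point: [n] and [d] depend on [e] only. Of the loss [2 * e], one
    [e] pays for passing to the periodic orbit and one for replacing [c] by [c']. *)
Lemma closing (R : realType) (e : R) : 0 < e -> exists2 n, (0 < n)%N &
  exists2 d : R, 0 < d & forall (l y c c' : R), l <= ln 2 -> `|c' - c| <= d ->
  (forall i, (i < n)%N -> 0 < chord (2 ^+ i * y - c)) ->
  - n%:R * (l - e) <= \sum_(i < n) ln (chord (2 ^+ i * y - c)) ->
  exists2 r, (0 < r)%N & exists k : int,
    (forall i, (i < r)%N -> 0 < chord (2 ^+ i * per_pt R r k - c')) /\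
    - r%:R * (l + 2 * e) <=
      \sum_(i < r) ln (chord (2 ^+ i * per_pt R r k - c')).
Proof.
move=> e0.
have pi0 := pi_gt0 R.
have ln20 : 0 < ln 2 :> R by rewrite ln_gt0// ltr1n.
pose w : R := 1 - expR (- e).
have w0 : 0 < w by rewrite subr_gt0 expR_lt1 oppr_lt0.
(* Points of one cell differ by at most [2 / (J + 1)] modulo 1; closing doubles this and [chord_lip]
   multiplies it by [pi]. The result has to be at most [w]. *)
pose J := Num.truncn (4 * pi / w).
have J0 : 0 < J.+1%:R :> R by rewrite ltr0n.
have hJ : 4 * pi * J.+1%:R^-1 <= w.
  have : 4 * pi / w < J.+1%:R by exact: truncnS_gt.
  by rewrite ltr_pdivrMr// ler_pdivrMr// [w * _]mulrC => /ltW.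
(* Long enough for a drift of [e] per step to climb [J + 1] levels of height [ln 2]. *)
pose n := (Num.truncn (J.+1%:R * ln 2 / e)).+1.
have hn : J.+1%:R * ln 2 <= n%:R * e.
  have : J.+1%:R * ln 2 / e < n%:R by exact: truncnS_gt.
  by rewrite ltr_pdivrMr// => /ltW.
(* A lower bound, free of [l], [y] and [c], for the distances of the periodic orbit to [c]; see
   [low2]. *)
pose eta : R := expR (- n%:R * (ln 2 + e)).
exists n => //; exists (w * eta / pi).
  by rewrite !mulr_gt0 ?invr_gt0// expR_gt0.
move=> l y c c' l2 cc' pos sumge.
pose a i := chord (2 ^+ i * y - c).
pose D m := \sum_(i < m) (ln (a i) + l).
have ale i : ln (a i) <= 0 by rewrite ln_le0// chord_le1.
have Dn : J.+1%:R * ln 2 <= D n.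
  rewrite (le_trans hn)// /D big_split/= sumr_const card_ord -[l *+ n]mulr_natl.
  have : - n%:R * (l - e) <= \sum_(i < n) ln (a i) := sumge.
  by lra.
have Db i : (i < n)%N -> D i.+1 <= D i + ln 2.
  by move=> _; rewrite /D big_ord_recr/= lerD2l; have := ale i; lra.
have D0 : D 0%N = 0 by rewrite /D big_ord0.
have Dsum m m' : (m <= m')%N -> D m <= D m' ->
    0 <= \sum_(i < m' - m) (ln (a (m + i)%N) + l).
  move=> /subnKC mm'.
  by rewrite -[X in _ <= D X -> _]mm' /D big_split_ord/= lerDl.
have /choice[col colP] := fun i : nat => frac_cell J (2 ^+ i * y).
have [p [q [pq qn pqcol Dq]]] := record_pigeonhole col ln20 D0 Db Dn.
have [kp hp] := colP p; have [kq hq] := colP q.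
pose r := (q - p)%N; have r0 : (0 < r)%N by rewrite subn_gt0.
have rn : (r <= n)%N by rewrite (leq_trans (leq_subr _ _)).
pose u := 2 ^+ p * y; pose k : int := kq - kp.
have hk : `|2 ^+ r * u - u - k%:~R| <= 2 / J.+1%:R.
  have -> : 2 ^+ r * u - u - k%:~R =
    (2 ^+ q * y - kq%:~R - (col q)%:R / J.+1%:R) -
    (2 ^+ p * y - kp%:~R - (col p)%:R / J.+1%:R).
    rewrite /u mulrA -exprD subnK ?(ltnW pq)// pqcol /k intrB; ring.
  apply: (le_trans (ler_normB _ _)).
  by rewrite [leRHS]mulr_natl mulr2n lerD.
have close := per_pt_closing r0 hk.
set z := per_pt R r k in close *.
(* By maximality of [D q] and [ln (a i) <= 0], [a (p + i) >= 2^-(q - p - i)],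
   which dominates the distance between the two orbits. *)
have alow i : (i < r)%N -> 2 ^- (r - i) <= a (p + i)%N.
  move=> ir; have piq : (p + i < q)%N by rewrite -ltn_subRL.
  have apos : 0 < a (p + i)%N by apply: pos; rewrite (leq_trans piq).
  have := Dsum _ _ (ltnW piq) (Dq _ piq).
  have [s sE] : exists s, (q - (p + i))%N = s.+1.
    by exists (q - (p + i)).-1; rewrite prednK// subn_gt0.
  rewrite sE big_ord_recl addn0 => h.
  have h2 : \sum_(j < s) (ln (a (p + i + lift ord0 j)%N) + l) <= s%:R * ln 2.
    rewrite -[s in s%:R]card_ord mulr_natl -sumr_const ler_sum// => j _.
    by have := ale (p + i + lift ord0 j)%N; lra.
  have h3 : - s.+1%:R * ln 2 <= ln (a (p + i)%N) by rewrite -natr1; lra.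
  have -> : (r - i = s.+1)%N by rewrite -sE subnDA.
  rewrite -(lnK (_ : a (p + i)%N \in Num.pos)) ?posrE//.
  rewrite -[leLHS]lnK ?posrE ?invr_gt0 ?exprn_gt0//.
  rewrite ler_expR lnV ?posrE ?exprn_gt0// lnXn//.
  by rewrite -[ln 2 *+ _]mulr_natl -mulNr.
have step1 i : (i < r)%N -> 0 < chord (2 ^+ i * z - c) /\
    ln (a (p + i)%N) - e <= ln (chord (2 ^+ i * z - c)).
  move=> ir; apply: chord_pos_stable.
    by apply: pos; rewrite (leq_trans _ qn)// -ltn_subRL.
  have -> : 2 ^+ i * z - c - (2 ^+ (p + i) * y - c) = 2 ^+ i * z - 2 ^+ i * u.
    by rewrite /u exprD; ring.
  apply: (@le_trans _ _ (w * 2 ^- (r - i))); last first.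
    by rewrite ler_pM2l// alow.
  apply: (@le_trans _ _ (pi * (2 * (2 / J.+1%:R) * 2 ^- (r - i)))).
    by rewrite ler_pM2l// close.
  have -> : pi * (2 * (2 / J.+1%:R) * 2 ^- (r - i)) =
      4 * pi / J.+1%:R * 2 ^- (r - i) :> R by ring.
  by apply: ler_wpM2r => //; rewrite invr_ge0 exprn_ge0.
(* The record gives [D p <= D q], so the average over the segment is at least [- l]; each term loses
   at most [e]. *)
have sum1 : - r%:R * (l + e) <= \sum_(i < r) ln (chord (2 ^+ i * z - c)).
  apply: (@le_trans _ _ (\sum_(i < r) (ln (a (p + i)%N) - e))); last first.
    by apply: ler_sum => i _; case: (step1 i).
  have := Dsum _ _ (ltnW pq) (Dq _ pq).
  rewrite -/r !big_split/= !sumr_const card_ord.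
  by rewrite -[l *+ r]mulr_natl -[(- e) *+ r]mulr_natl; lra.
(* All terms are nonpositive, so each single one is at least the whole sum, and [r <= n]. *)
have low2 i : (i < r)%N -> eta <= chord (2 ^+ i * z - c).
  move=> ir; have [zpos _] := step1 i ir.
  rewrite -(lnK (_ : chord _ \in Num.pos)) ?posrE// ler_expR.
  apply: (@le_trans _ _ (- r%:R * (l + e))).
    rewrite !mulNr lerN2; apply: (@le_trans _ _ (r%:R * (ln 2 + e))).
      by rewrite ler_wpM2l//; lra.
    by rewrite ler_wpM2r ?ler_nat//; lra.
  apply: (le_trans sum1); rewrite (bigD1 (Ordinal ir))//= gerDl.
  by apply: sumr_le0 => j _; rewrite ln_le0// chord_le1.
have step2 i : (i < r)%N -> 0 < chord (2 ^+ i * z - c') /\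
    ln (chord (2 ^+ i * z - c)) - e <= ln (chord (2 ^+ i * z - c')).
  move=> ir; have [zpos _] := step1 i ir; apply: chord_pos_stable => //.
  have -> : 2 ^+ i * z - c' - (2 ^+ i * z - c) = - (c' - c) by ring.
  rewrite normrN (@le_trans _ _ (w * eta))//.
    by rewrite mulrC -ler_pdivlMr.
  by rewrite ler_pM2l// low2.
exists r => //; exists k; split; first by move=> i ir; case: (step2 i ir).
apply: (@le_trans _ _ (\sum_(i < r) (ln (chord (2 ^+ i * z - c)) - e))).
  by rewrite big_split/= sumr_const card_ord -[(- e) *+ r]mulr_natl; lra.
by apply: ler_sum => i _; case: (step2 i).
Qed.

(** * The doubling map on the torus *)

Definition torus_pi (R : realType) (t : R) : torus R := \pi_(torus R)%qT t.

Lemma torus_pi_continuous (R : realType) : continuous (@torus_pi R).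
Proof. exact: pi_continuous. Qed.

Lemma torus_piK (R : realType) (x : torus R) : torus_pi (repr x) = x.
Proof. exact: reprK. Qed.

Lemma torus_piP (R : realType) (s t : R) :
  torus_pi s = torus_pi t <-> exists k : int, s = t + k%:~R.
Proof.
have E : torus_pi s = torus_pi t <-> s - t \is a Num.int.
  have -> : (s - t \is a Num.int) = _ := @Quotient.idealrBE R (integers R) s t.
  by split=> [h|/eqP//]; apply/eqP.
rewrite E; split=> [/intrP[k kE]|[k ->]].
  by exists k; rewrite -kE; ring.
by apply/intrP; exists k; rewrite addrAC subrr add0r.
Qed.

Lemma torus_piD (R : realType) (s t : R) :
  torus_pi (s + t) = torus_pi s + torus_pi t.
Proof. exact: (@Quotient.pi_add R (integers R) s t). Qed.

Lemma torus_piB (R : realType) (s t : R) :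
  torus_pi (s - t) = torus_pi s - torus_pi t.
Proof.
by apply/(addIr (torus_pi t)); rewrite -torus_piD !subrK.
Qed.

Lemma doubling_torus_pi (R : realType) (t : R) :
  doubling (torus_pi t) = torus_pi (2 * t).
Proof. by rewrite /doubling mulr2n -torus_piD -mulr2n mulr_natl. Qed.

Lemma iter_doubling_torus_pi (R : realType) (n : nat) (t : R) :
  iter n (@doubling R) (torus_pi t) = torus_pi (2 ^+ n * t).
Proof.
elim: n => [|n IH]; first by rewrite mul1r.
by rewrite iterS IH doubling_torus_pi mulrA -exprS.
Qed.

Lemma chord_torus_pi (R : realType) (s t : R) :
  torus_pi s = torus_pi t -> chord s = chord t.
Proof. by move=> /torus_piP[k ->]; rewrite chordDint. Qed.

Lemma psi_torus_pi (R : realType) (c x : R) :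
  psi (torus_pi c) (torus_pi x) = (2%:E * lne (chord (x - c))%:E)%E.
Proof.
rewrite /psi -/(chord _) -torus_piB (@chord_torus_pi _ _ (x - c))//.
by rewrite torus_piK.
Qed.

Lemma psi_le0 (R : realType) (c x : torus R) : (psi c x <= 0)%E.
Proof.
rewrite -[c]torus_piK -[x]torus_piK psi_torus_pi mule_ge0_le0//.
by rewrite lne_le0 lee_fin chord_le1.
Qed.

Lemma torus_continuous (R : realType) (Z : topologicalType) (f : torus R -> Z) :
  continuous (f \o @torus_pi R) -> continuous f.
Proof. by move=> h; apply/quotient_continuous. Qed.

Lemma open_torus_measurable (R : realType) (U : set (torus R)) :
  open U -> measurable (U : set (borel_torus R)).
Proof. by move=> oU; apply: sub_sigma_algebra. Qed.

Lemma continuous_doubling (R : realType) : continuous (@doubling R).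
Proof.
apply: torus_continuous.
have -> : @doubling R \o @torus_pi R = @torus_pi R \o ( *%R 2).
  by apply/funext => t /=; rewrite doubling_torus_pi.
move=> t; apply: continuous_comp; first exact: mulrl_continuous.
exact: torus_pi_continuous.
Qed.

Lemma measurable_doubling (R : realType) :
  measurable_fun setT (@doubling R : borel_torus R -> borel_torus R).
Proof.
apply: (@measurability _ _ (borel_torus R) (borel_torus R) setT (@doubling R)
  (@open (torus R))) => // _ [U oU <-].
rewrite setTI; apply: open_torus_measurable.
by have /continuousP := @continuous_doubling R; exact.
Qed.

Lemma continuous_chord (R : realType) : continuous (@chord R).
Proof.
move=> t; apply: continuous_comp; last exact: norm_continuous.
by apply: continuous_comp; [exact: mulrl_continuous|exact: continuous_sin].
Qed.

(** [repr] is not continuous, but by periodicity the composition with [torus_pi] is a translate of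
    [chord], so the function is continuous on the quotient. *)
Lemma measurable_chord_torus (R : realType) (c : R) :
  measurable_fun setT (fun x : borel_torus R => chord (repr (x : torus R) - c)).
Proof.
have cont : continuous (fun x : torus R => chord (repr x - c)).
  apply: torus_continuous => t /=.
  have -> : (fun x : torus R => chord (repr x - c)) \o @torus_pi R =
      @chord R \o (fun t => t - c).
    apply/funext => s /=; apply: chord_torus_pi; rewrite !torus_piB torus_piK//.
  apply: continuous_comp; last exact: continuous_chord.
  by apply: continuousB; [exact: cvg_id|exact: cvg_cst].
apply: (measurability _ (RGenOpens.measurableE R)).
move=> _ [_ [a [b ->] <-]]; rewrite setTI; apply: open_torus_measurable.
by have /continuousP := cont; apply; exact: interval_open.
Qed.

Lemma measurable_lne_EFin (R : realType) :
  measurable_fun [set: R] (@lne R \o EFin).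
Proof.
apply: measurable_fun_ifT => //=.
  exact: measurable_fun_ler.
apply/measurable_EFinP; exact: measurable_ln.
Qed.

Lemma measurable_psi (R : realType) (c : torus R) :
  measurable_fun setT (psi c : borel_torus R -> \bar R).
Proof.
have -> : psi c = fun x : torus R =>
    (2%:E * lne (chord (repr x - repr c))%:E)%E.
  apply/funext => x.
  by rewrite -[in LHS](torus_piK c) -[in LHS](torus_piK x) psi_torus_pi.
apply: measurable_funeM.
exact: (measurableT_comp (@measurable_lne_EFin R)
  (@measurable_chord_torus R _)).
Qed.

(** * Invariant measures *)

(** The index [n] stands for [n + 1] orbit points, which keeps the normalising factor meaningful for
    every [n]. *)
Definition orbit_measure (R : realType) (n : nat) (t : R) :
    set (borel_torus R) -> \bar R :=
  mscale (n.+1%:R^-1)%:nng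
    (msum (fun i => \d_(torus_pi (2 ^+ i * t) : borel_torus R)) n.+1).

HB.instance Definition _ (R : realType) (n : nat) (t : R) :=
  Measure.on (orbit_measure n t).

Lemma orbit_measure_setT (R : realType) (n : nat) (t : R) :
  orbit_measure n t setT = 1%E.
Proof.
rewrite /orbit_measure /mscale/= /msum.
rewrite (eq_bigr (fun=> 1%E)); last by move=> i _; exact: diracT.
rewrite sumEFin sumr_const card_ord -EFinM -[1 *+ _]/(n.+1%:R) mulVf//.
Qed.

HB.instance Definition _ (R : realType) (n : nat) (t : R) :=
  @Measure_isProbability.Build _ _ R (orbit_measure n t)
    (orbit_measure_setT n t).

(** Taking preimages shifts the sum of Dirac masses by one; periodicity returns the last mass to the
    start. *)
Lemma orbit_measure_invariant (R : realType) (n : nat) (t : R) :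
  torus_pi (2 ^+ n.+1 * t) = torus_pi t ->
  invariant_measure (orbit_measure n t).
Proof.
move=> tn A mA; rewrite /orbit_measure /mscale/= /msum; congr (_ * _)%E.
transitivity (\sum_(i < n.+1)
    \d_(torus_pi (2 ^+ i.+1 * t) : borel_torus R) A : \bar R)%E.
  apply: eq_bigr => i _; rewrite !diracE exprS -mulrA -doubling_torus_pi.
  by congr ((_ : bool)%:R%:E); apply/idP/idP; rewrite !inE.
by rewrite [RHS]big_ord_recl big_ord_recr /= mul1r tn addeC.
Qed.

Lemma ge0_integral_orbit_measure (R : realType) (n : nat) (t : R)
    (f : borel_torus R -> \bar R) :
  measurable_fun setT f -> (forall x, (0 <= f x)%E) ->
  (\int[orbit_measure n t]_x f x =
   (n.+1%:R^-1)%:E * \sum_(i < n.+1) f (torus_pi (2 ^+ i * t)))%E.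
Proof.
move=> mf f0; rewrite ge0_integral_mscale// ge0_integral_measure_sum//.
congr (_ * _)%E; apply: eq_bigr => i _.
by rewrite integral_dirac// diracT mul1e.
Qed.

(** Reduces to a nonnegative integrand, where the integration theorems allow the value [+oo]. *)
Lemma integral_psiN (R : realType) (mu : probability (borel_torus R) R)
    (c : torus R) :
  (\int[mu]_x psi c x = - \int[mu]_x - psi c x)%E.
Proof.
rewrite -integral_ge0N; last by move=> x _; rewrite leeNr oppe0 psi_le0.
by apply: eq_integral => x _; rewrite oppeK.
Qed.

Lemma measurable_psiN (R : realType) (c : torus R) :
  measurable_fun setT (fun x : borel_torus R => - psi c x)%E.
Proof.
exact: (measurableT_comp (@oppe_measurable R setT) (measurable_psi c)).
Qed.

Lemma psiN_ge0 (R : realType) (c x : torus R) : (0 <= - psi c x)%E.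
Proof. by rewrite leeNr oppe0 psi_le0. Qed.

Lemma integral_psi_orbit (R : realType) (n : nat) (c t : R) :
  (forall i, (i < n.+1)%N -> 0 < chord (2 ^+ i * t - c)) ->
  (\int[orbit_measure n t]_x psi (torus_pi c) x =
   (n.+1%:R^-1 * (2 * \sum_(i < n.+1) ln (chord (2 ^+ i * t - c))))%:E)%E.
Proof.
move=> pos; rewrite integral_psiN ge0_integral_orbit_measure; last 2 first.
- exact: measurable_psiN.
- by move=> x; exact: psiN_ge0.
have -> : (\sum_(i < n.+1) - psi (torus_pi c) (torus_pi (2 ^+ i * t)) =
   (\sum_(i < n.+1) - (2 * ln (chord (2 ^+ i * t - c))))%:E)%E.
  rewrite -sumEFin; apply: eq_bigr => i _.
  by rewrite psi_torus_pi lne_EFin ?pos// EFinN EFinM.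
by rewrite -EFinM -EFinN sumrN mulrN opprK -mulr_sumr.
Qed.

Lemma integral_psi_orbit_singular (R : realType) (n : nat) (c : R) :
  (\int[orbit_measure n c]_x psi (torus_pi c) x = -oo)%E.
Proof.
rewrite integral_psiN ge0_integral_orbit_measure; last 2 first.
- exact: measurable_psiN.
- by move=> x; exact: psiN_ge0.
rewrite big_ord_recl /= mul1r psi_torus_pi subrr /chord mulr0 sin0 normr0.
rewrite le0_lneNy// gt0_muleNy ?lte_fin//= addye; last first.
  rewrite gt_eqF// (@lt_le_trans _ _ 0%E)// ?ltNyr// sume_ge0// => i _.
  exact: psiN_ge0.
by rewrite gt0_muley ?lte_fin ?invr_gt0.
Qed.

Lemma ge0_integral_doubling (R : realType) (mu : probability (borel_torus R) R)
    (f : borel_torus R -> \bar R) : invariant_measure mu ->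
  measurable_fun setT f -> (forall x, (0 <= f x)%E) ->
  (\int[mu]_x f (doubling x) = \int[mu]_x f x)%E.
Proof.
move=> inv mf f0.
have := @ge0_integral_pushforward _ _ _ _ R _ (@measurable_doubling R) mu setT f
  measurableT mf (fun x _ => f0 x).
rewrite preimage_setT => <-.
apply: eq_measure_integral => [|mT A mA _]; first exact: measurable_doubling.
exact: (inv A mA).
Qed.

Lemma ge0_integral_iter_doubling (R : realType)
    (mu : probability (borel_torus R) R) (f : borel_torus R -> \bar R)
    (n : nat) :
  invariant_measure mu ->
  measurable_fun setT f -> (forall x, (0 <= f x)%E) ->
  measurable_fun setT (fun x : borel_torus R => f (iter n (@doubling R) x)) /\
  (\int[mu]_x f (iter n (@doubling R) x) = \int[mu]_x f x)%E.
Proof.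
move=> inv mf f0; elim: n => [//|n [mn IH]].
have E : (fun x => f (iter n.+1 (@doubling R) x)) =
    (fun x => f (iter n (@doubling R) x)) \o @doubling R.
  by apply/funext => x /=; rewrite -iterS iterSr.
split.
  by rewrite E; exact: (measurableT_comp mn (@measurable_doubling R)).
rewrite E -IH.
exact: (@ge0_integral_doubling _ mu (fun x => f (iter n (@doubling R) x))).
Qed.

(** By invariance the Birkhoff sum of length [n] has integral [n] times that of [psi], so some point
    does at least as well as the mean. *)
Lemma exists_large_birkhoff (R : realType) (mu : probability (borel_torus R) R)
    (c b : R) (n : nat) : invariant_measure mu -> (0 < n)%N ->
  ((2 * b)%:E < \int[mu]_x psi (torus_pi c) x)%E ->
  exists y : R, (forall i, (i < n)%N -> 0 < chord (2 ^+ i * y - c)) /\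
    n%:R * b <= \sum_(i < n) ln (chord (2 ^+ i * y - c)).
Proof.
move=> inv n0 hb.
pose f (x : borel_torus R) := (- psi (torus_pi c) x)%E.
have mf : measurable_fun setT f by exact: measurable_psiN.
have f0 x : (0 <= f x)%E by exact: psiN_ge0.
pose S (x : borel_torus R) := (\sum_(i < n) f (iter i (@doubling R) x))%E.
have mfi i := (ge0_integral_iter_doubling i inv mf f0).1.
have intS : (\int[mu]_x S x = n%:R%:E * \int[mu]_x f x)%E.
  rewrite ge0_integral_sum//.
  under eq_bigr do rewrite (ge0_integral_iter_doubling _ inv mf f0).2.
  by rewrite sumr_const card_ord mule_natl.
have hf : (\int[mu]_x f x < (- (2 * b))%:E)%E.
  by rewrite EFinN lteNr; rewrite integral_psiN in hb.
have [y hy] : exists y : torus R, (S y < (n%:R * - (2 * b))%:E)%E.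
  apply: contrapT => /forallNP h.
  have hS x : ((n%:R * - (2 * b))%:E <= S x)%E by rewrite leNgt; apply/negP/h.
  have b2 : 0 <= - (2 * b).
    rewrite -lee_fin (le_trans _ (ltW hf))//.
    by apply: integral_ge0 => x _; exact: f0.
  have : (\int[mu]_x (cst (n%:R * - (2 * b))%:E x) <= \int[mu]_x S x)%E.
    apply: ge0_le_integral => //.
    - by move=> x _; rewrite lee_fin mulr_ge0.
    - exact: emeasurable_sum.
  rewrite integral_cst// [X in (_ * X)%E]probability_setT mule1 intS EFinM.
  by rewrite lee_pmul2l ?lte_fin ?ltr0n// leNgt hf.
exists (repr y); have Sy : S y = (\sum_(i < n)
    - (2%:E * lne (chord (2 ^+ i * repr y - c))%:E))%E.
  apply: eq_bigr => i _.
  by rewrite /f -[in LHS](torus_piK y) iter_doubling_torus_pi psi_torus_pi.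
(* An orbit point at the singularity would make [S y] equal to [+oo]. *)
have pos i : (i < n)%N -> 0 < chord (2 ^+ i * repr y - c).
  move=> ni; rewrite lt_neqAle chord_ge0 andbT eq_sym; apply/eqP => ci0.
  move: hy; rewrite Sy (bigD1 (Ordinal ni))//= ci0.
  rewrite lexx gt0_muleNy ?lte_fin//= addye ?ltNge ?leey//.
  rewrite gt_eqF// (@lt_le_trans _ _ 0%E)// ?ltNyr// sume_ge0// => j _.
  by rewrite -psi_torus_pi psiN_ge0.
split => //.
have {}Sy : S y = (- (2 * \sum_(i < n) ln (chord (2 ^+ i * repr y - c))))%:E.
  rewrite Sy mulr_sumr -sumrN -sumEFin; apply: eq_bigr => i _.
  by rewrite lne_EFin ?pos// EFinN EFinM.
by move: hy; rewrite Sy lte_fin => h; lra.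
Qed.

(** * The minimal integral *)

(* [softN c n] increases to [- psi c] and bounds [- psi c'] from below for [c']
   close to [c]. *)
Definition softN (R : realType) (c : R) (n : nat) (x : torus R) : R :=
  - (2 * ln (Num.min (chord (repr x - c) + n.+1%:R^-1) 1)).

Lemma soft_arg_gt0 (R : realType) (u : R) (n : nat) : 0 <= u ->
  0 < Num.min (u + n.+1%:R^-1) 1.
Proof. by move=> u0; rewrite lt_min ltr01 andbT ltr_wpDl// invr_gt0. Qed.

Lemma softN_ge0 (R : realType) (c : R) (n : nat) (x : torus R) :
  0 <= softN c n x.
Proof.
rewrite /softN oppr_ge0 pmulr_rle0// ln_le0// ge_min lexx orbT//.
Qed.

Lemma softN_homo (R : realType) (c : R) (x : torus R) :
  {homo (fun n => softN c n x) : m n / (m <= n)%N >-> m <= n}.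
Proof.
move=> m n mn; rewrite lerN2 ler_pM2l//.
rewrite ler_ln ?posrE ?soft_arg_gt0 ?chord_ge0//.
rewrite le_min !ge_min lexx orbT andbT lerD2l lef_pV2 ?posrE//.
by rewrite ler_nat ltnS mn.
Qed.

Lemma measurable_softN (R : realType) (c : R) (n : nat) :
  measurable_fun setT (softN c n : borel_torus R -> R).
Proof.
apply: measurableT_comp => //; apply: measurable_funM => //.
apply: (measurableT_comp (@measurable_ln R)); apply: measurable_minr => //.
by apply: measurable_funD => //; exact: measurable_chord_torus.
Qed.

(** The summand [1 / (n + 1)] in [softN] absorbs the change of [chord] as [c] moves; the cap at 1 is
    harmless by [chord_le1]. *)
Lemma softN_le (R : realType) (c c' : R) (n : nat) (x : torus R) :
  pi * `|c' - c| <= n.+1%:R^-1 ->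
  ((softN c n x)%:E <= - psi (torus_pi c') x)%E.
Proof.
move=> h; rewrite -{2}(torus_piK x) psi_torus_pi /softN.
have hu : chord (repr x - c') <= chord (repr x - c) + n.+1%:R^-1.
  have := le_trans (ler_norm _) (chord_lip (repr x - c') (repr x - c)).
  have -> : repr x - c' - (repr x - c) = - (c' - c) by ring.
  by rewrite normrN -lerBlDl => /le_trans; apply.
have [u0|u0] := ltP 0 (chord (repr x - c')); last first.
  by rewrite le0_lneNy// gt0_muleNy ?lte_fin//= leey.
rewrite lne_EFin// -EFinM -EFinN lee_fin lerN2 ler_pM2l//.
by rewrite ler_ln ?posrE ?soft_arg_gt0 ?chord_ge0// le_min hu chord_le1.
Qed.

Lemma softN_gt (R : realType) (c b : R) (x : torus R) :
  (b%:E < - psi (torus_pi c) x)%E -> exists n, b < softN c n x.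
Proof.
rewrite -{1}(torus_piK x) psi_torus_pi => hb.
set u := chord (repr x - c) in hb *.
have hu : u < expR (- (b / 2)).
  have [u0|u0] := ltP 0 u; last by rewrite (le_lt_trans u0)// expR_gt0.
  rewrite -ltr_ln ?posrE ?expR_gt0// expRK.
  by move: hb; rewrite lne_EFin// -EFinM -EFinN lte_fin; lra.
pose w := expR (- (b / 2)) - u.
have w0 : 0 < w by rewrite subr_gt0.
exists (Num.truncn w^-1).
have hw : (Num.truncn w^-1).+1%:R^-1 < w.
  by rewrite -[ltRHS]invrK ltf_pV2 ?posrE ?invr_gt0// truncnS_gt.
rewrite /softN -/u; set v := Num.min _ _.
have v0 : 0 < v by rewrite soft_arg_gt0// chord_ge0.
have : ln v < - (b / 2).
  rewrite -[ltRHS]expRK ltr_ln ?posrE ?expR_gt0//.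
  by rewrite gt_min; apply/orP; left; rewrite -ltrBrDl.
lra.
Qed.

(** Monotone convergence yields one [n] for which the integral of [softN c n] already exceeds [- a];
    [softN_le] passes this bound to all nearby [c']. *)
Lemma integral_psi_usc (R : realType) (mu : probability (borel_torus R) R)
    (c a : R) : (\int[mu]_x psi (torus_pi c) x < a%:E)%E ->
  exists2 d, 0 < d & forall c', `|c' - c| <= d ->
    (\int[mu]_x psi (torus_pi c') x < a%:E)%E.
Proof.
rewrite integral_psiN lteNl -EFinN => ha.
pose g n (x : borel_torus R) := (softN c n x)%:E.
have mg n : measurable_fun setT (g n).
  by apply/measurable_EFinP; exact: measurable_softN.
have g0 n x : (0 <= g n x)%E by rewrite lee_fin softN_ge0.
have ndg x : nondecreasing_seq (g^~ x).
  by move=> m n mn; rewrite lee_fin softN_homo.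
have le_lim x : (- psi (torus_pi c) x <= limn (g^~ x))%E.
  rewrite leNgt; apply/negP => hlt.
  have gle n : (g n x <= limn (g^~ x))%E.
    apply: lime_ge; first exact: ereal_nondecreasing_is_cvgn.
    by near=> m; apply: ndg; near: m; exists n.
  have [l lE] : exists l, limn (g^~ x) = l%:E.
    case: (limn _) (gle 0%N) hlt => [l||]; first by exists l.
    - by move=> _; rewrite ltNge leey.
    - by rewrite leeNy_eq.
  rewrite lE in hlt gle; have [n] := softN_gt hlt.
  by rewrite ltNge -lee_fin gle.
have hlim : ((- a)%:E < limn (fun n => \int[mu]_x g n x))%E.
  rewrite -monotone_convergence//; apply: (lt_le_trans ha).
  apply: ge0_le_integral => //.
  - by move=> x _; exact: psiN_ge0.
  - exact: measurable_psiN.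
  - apply: emeasurable_fun_cvg mg _ => x _.
    exact: ereal_nondecreasing_is_cvgn.
have [n hn] : exists n, ((- a)%:E < \int[mu]_x g n x)%E.
  apply: contrapT => /forallNP h; move: hlim; apply/negP; rewrite -leNgt.
  apply: lime_le.
    apply: ereal_nondecreasing_is_cvgn => m n mn.
    by apply: ge0_le_integral => // x _; exact: ndg.
  by apply: nearW => n; rewrite leNgt; apply/negP/h.
exists (n.+1%:R^-1 / pi); first by rewrite divr_gt0// ?invr_gt0// pi_gt0.
move=> c' cc'; rewrite integral_psiN lteNl -EFinN; apply: (lt_le_trans hn).
apply: ge0_le_integral => //; first exact: measurable_psiN.
move=> x _; apply: softN_le.
by rewrite mulrC -ler_pdivlMr// pi_gt0.
Unshelve. all: by end_near. Qed.

Lemma alpha_usc (R : realType) : upper_semicontinuous (@alpha R).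
Proof.
move=> x a xa; exists [set y | (alpha y < a%:E)%E] => //.
apply: open_nbhs_nbhs; split => //.
(* Openness in the quotient topology is by definition openness of the preimage. *)
change (open (@torus_pi R @^-1` [set y | (alpha y < a%:E)%E])).
rewrite openE => t /= /ereal_inf_lt[_ [mu inv <-] hmu].
have [d d0 hd] := integral_psi_usc hmu.
apply/nbhs_ballP; exists d => // t' /= tt'.
apply: le_lt_trans (hd t' _); last first.
  by rewrite distrC ltW.
by apply: ereal_inf_lbound; exists mu.
Qed.

(** For fixed [r] these points form a grid of mesh [1 / (2 ^+ r.+1 - 1)]. *)
Lemma per_pt_dense (R : realType) (t d : R) : 0 < d ->
  exists r k, `|t - per_pt R r.+1 k| < d.
Proof.
move=> d0; pose r := Num.truncn d^-1; exists r.
pose m : R := 2 ^+ r.+1 - 1.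
have m1 : d^-1 < m.
  rewrite (lt_le_trans (truncnS_gt _))// /m lerBrDr natr1 -natrX ler_nat.
  exact: ltn_expl.
have m0 : 0 < m by rewrite (lt_trans _ m1)// invr_gt0.
exists (Num.floor (t * m)).
have /andP[h1 h2] := floor_itv (t * m).
rewrite intrD in h2.
have -> : t - per_pt R r.+1 (Num.floor (t * m)) =
    (t * m - (Num.floor (t * m))%:~R) / m.
  by rewrite /per_pt -/m; field; rewrite gt_eqF.
rewrite normrM (ger0_norm (_ : 0 <= m^-1)) ?invr_ge0 ?(ltW m0)//.
rewrite ger0_norm ?subr_ge0// ltr_pdivrMr//.
apply: (@lt_trans _ _ 1); first lra.
by rewrite -ltr_pdivrMl// mulr1.
Qed.

Lemma torus_pi_per_pt (R : realType) (r : nat) (k : int) : (0 < r)%N ->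
  torus_pi (2 ^+ r * per_pt R r k) = torus_pi (per_pt R r k).
Proof. by move=> r0; apply/torus_piP; exists k; exact: per_ptE. Qed.

Lemma alpha_per_pt (R : realType) (r : nat) (k : int) :
  alpha (torus_pi (per_pt R r.+1 k)) = -oo%E.
Proof.
apply/eqP; rewrite -leeNy_eq.
rewrite -(integral_psi_orbit_singular r (per_pt R r.+1 k)).
apply: ereal_inf_lbound.
exists (orbit_measure r (per_pt R r.+1 k)) => //.
exact/orbit_measure_invariant/torus_pi_per_pt.
Qed.

(** Where the value is [-oo], upper semicontinuity is already continuity. Elsewhere continuity would
    give a neighbourhood with [alpha > -oo], which contains a periodic point. *)
Lemma alpha_continuousP (R : realType) (c : torus R) :
  {for c, continuous (@alpha R)} <-> alpha c = -oo%E.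
Proof.
split=> [cc|cNy]; last first.
  rewrite /prop_for /continuous_at cNy.
  apply/(@cvgeNyPlt _ _ _ (nbhs_filter c)) => a.
  have [|V Vc hV] := @alpha_usc R c a; first by rewrite cNy ltNyr.
  exact: (@filterS _ _ (nbhs_filter c) _ _ hV Vc).
apply/eqP; rewrite -leeNy_eq leNgt; apply/negP => hc.
have hV : nbhs c [set y | (-oo < alpha y)%E].
  apply: (cc [set y | (-oo < y)%E]).
  by apply: open_nbhs_nbhs; split => //; exact: open_ereal_gt_ereal.
have : nbhs (repr c) (@torus_pi R @^-1` [set y | (-oo < alpha y)%E]).
  by apply: torus_pi_continuous; rewrite torus_piK.
move=> /nbhs_ballP[d d0 hd].
have [r [k hk]] := per_pt_dense (repr c) d0.
by have := hd _ hk; rewrite /= alpha_per_pt ltxx.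
Qed.

(** * The maximal integral *)

Lemma beta_ge_orbit (R : realType) (n : nat) (c t : R) :
  torus_pi (2 ^+ n.+1 * t) = torus_pi t ->
  (forall i, (i < n.+1)%N -> 0 < chord (2 ^+ i * t - c)) ->
  ((n.+1%:R^-1 * (2 * \sum_(i < n.+1) ln (chord (2 ^+ i * t - c))))%:E
    <= beta (torus_pi c))%E.
Proof.
move=> per pos; rewrite -integral_psi_orbit//; apply: ereal_sup_ubound.
by exists (orbit_measure n t) => //; exact: orbit_measure_invariant.
Qed.

Lemma beta_le0 (R : realType) (c : torus R) : (beta c <= 0)%E.
Proof.
apply: ge_ereal_sup => _ [mu _ <-].
rewrite integral_psiN oppe_le0; apply: integral_ge0 => x _; exact: psiN_ge0.
Qed.

(** From [sin (3 x) = sin x * (3 - 4 * sin x ^+ 2)], which vanishes at [x = pi / 3]. *)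
Lemma sin_pi3_sqr (R : realType) : sin (pi / 3 : R) ^+ 2 = 3 / 4.
Proof.
set x : R := pi / 3.
have sx : 0 < sin x.
  apply: sin_gt0_pi; have := pi_gt0 R; rewrite /x => ?.
  by apply/andP; split; lra.
have : sin (x *+ 2 + x) = 0.
  by rewrite -mulrSr -[x *+ 3]mulr_natr /x divfK// sinpi.
rewrite sinD sin_mulr2n cos_mulr2n.
have := cos2Dsin2 x; move: (sin x) (cos x) sx => s k sx h1 h2.
have h3 : s * (3 - 4 * s ^+ 2) = 0.
  have -> : 3 - 4 * s ^+ 2 = 4 * k ^+ 2 - 1 by lra.
  by rewrite -[RHS]h2; ring.
move/eqP: h3; rewrite mulf_eq0 gt_eqF//= => /eqP; lra.
Qed.

(** This is [sin (v - u) * sin (v + u) = sin v ^+ 2 - sin u ^+ 2] at [v = pi / 3]. *)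
Lemma chord_third (R : realType) (c : R) :
  chord (3^-1 - c) * chord (2 * 3^-1 - c) = `|3 / 4 - chord c ^+ 2|.
Proof.
rewrite /chord -normrM real_normK ?num_real//; congr `|_|.
set u := pi * c.
have -> : pi * (3^-1 - c) = pi / 3 - u by rewrite /u; ring.
have -> : pi * (2 * 3^-1 - c) = - (pi / 3 + u) + pi by rewrite /u; field.
rewrite sinDpi sinN opprK sinB sinD -(sin_pi3_sqr R).
have := cos2Dsin2 (pi / 3 : R); have := cos2Dsin2 u.
move: (sin u) (cos u) (sin (pi / 3)) (cos (pi / 3)) => s k s' k' h h'.
have -> : (s' * k - k' * s) * (s' * k + k' * s) =
  s' ^+ 2 * k ^+ 2 - k' ^+ 2 * s ^+ 2 by ring.
have -> : k ^+ 2 = 1 - s ^+ 2 by lra.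
have -> : k' ^+ 2 = 1 - s' ^+ 2 by lra.
ring.
Qed.

(* Either the fixed point [0] or the cycle [{1/3, 2/3}] is far from [c]. *)
Lemma beta_ge (R : realType) (c : R) :
  ((ln (3 / 8))%:E <= beta (torus_pi c))%E.
Proof.
have p38 : 0 < 3 / 8 :> R by lra.
(* The threshold is half of [3 / 4], so [chord c ^+ 2] or its distance to [3 / 4] is at least
   [3 / 8]; the logarithms of these two numbers are the two orbit averages. *)
have [hc|hc] := leP (3 / 8) (chord c ^+ 2).
  have c0 : 0 < chord c.
    rewrite lt_neqAle chord_ge0 andbT; apply/eqP => c0.
    by move: hc; rewrite -c0 expr0n/=; lra.
  have cE : chord (2 ^+ 0 * 0 - c) = chord c.
    by rewrite mulr0 sub0r /chord mulrN sinN normrN.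
  apply: le_trans (@beta_ge_orbit R 0 c 0 _ _).
  - rewrite big_ord1 cE invr1 mul1r lee_fin [2 * _]mulr_natl -lnXn//.
    by rewrite ler_ln ?posrE// exprn_gt0.
  - by rewrite !mulr0.
  - by case=> // _; rewrite cE.
have prod_ge : 3 / 8 <= chord (3^-1 - c) * chord (2 * 3^-1 - c).
  by rewrite chord_third (le_trans _ (ler_norm _))//; lra.
have c1 : 0 < chord (3^-1 - c).
  rewrite lt_neqAle chord_ge0 andbT; apply/eqP => c0.
  by move: prod_ge; rewrite -c0 mul0r; lra.
have c2 : 0 < chord (2 * 3^-1 - c).
  rewrite lt_neqAle chord_ge0 andbT; apply/eqP => c0.
  by move: prod_ge; rewrite -c0 mulr0; lra.
apply: le_trans (@beta_ge_orbit R 1 c 3^-1 _ _).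
- rewrite !big_ord_recl big_ord0 /= mul1r expr1 addr0 -lnM ?posrE//.
  by rewrite mulKf// lee_fin ler_ln ?posrE// mulr_gt0.
- by apply/torus_piP; exists 1; field.
- by case=> [|[|//]] _; rewrite ?mul1r ?expr1.
Qed.

Lemma beta_fin_num (R : realType) (c : R) : beta (torus_pi c) \is a fin_num.
Proof.
rewrite fin_numElt (lt_le_trans _ (beta_ge c)) ?ltNyr//.
by rewrite (le_lt_trans (beta_le0 _)).
Qed.

Lemma beta_uniform_lsc (R : realType) (e : R) : 0 < e -> exists2 d : R, 0 < d &
  forall c c' : R, `|c' - c| <= d ->
  (beta (torus_pi c) <= beta (torus_pi c') + e%:E)%E.
Proof.
move=> e0; have l32 : 0 < ln (3 / 2) :> R by rewrite ln_gt0//; lra.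
(* With the [l] below, [- 2 * (l + 2 * e1) = B - 7 * e1], whence [e / 7]. The second bound and
   [beta_ge] give [l <= ln 2]. *)
pose e1 := Num.min (e / 7) (ln (3 / 2) / 3).
have e10 : 0 < e1 by rewrite lt_min !divr_gt0.
have e1e : 7 * e1 <= e.
  have : e1 <= e / 7 by rewrite ge_min lexx.
  lra.
have e1l : 3 * e1 <= ln (3 / 2).
  have : e1 <= ln (3 / 2) / 3 by rewrite ge_min lexx orbT.
  lra.
have lE : ln (3 / 2) = 2 * ln 2 + ln (3 / 8) :> R.
  have -> : 3 / 2 = 2 ^+ 2 * (3 / 8) :> R by field.
  by rewrite lnM ?posrE ?lnXn ?exprn_gt0// [2 * _]mulr_natl.
have [n n0 [d d0 close]] := closing e10.
exists d => // c c' cc'.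
have := beta_fin_num c; have := beta_ge c.
case E : (beta (torus_pi c)) => [B||]// Bge _; rewrite lee_fin in Bge.
(* Chosen so that [- 2 * (l - e1) = B - e1], just below the supremum [B]. *)
pose l : R := - B / 2 + 3 / 2 * e1.
have lln2 : l <= ln 2 by rewrite /l; lra.
have [_ [mu inv <-] hmu] : exists2 y,
    [set \int[mu]_x psi (torus_pi c) x | mu in @invariant_measure R]%E y &
    ((2 * - (l - e1))%:E < y)%E.
  apply: ereal_sup_gt; rewrite -/(beta _) E lte_fin /l; lra.
have [y [pos sumy]] := exists_large_birkhoff inv n0 hmu.
have {}sumy : - n%:R * (l - e1) <= \sum_(i < n) ln (chord (2 ^+ i * y - c)).
  by rewrite mulNr -mulrN.
have [r + [k]] := close l y c c' lln2 cc' pos sumy.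
case: r => // r _ [posk sumk].
have hb := @beta_ge_orbit R r c' (per_pt R r.+1 k)
  (torus_pi_per_pt R k (ltn0Sn r)) posk.
rewrite -leeBlDr// -EFinB (le_trans _ hb)// lee_fin.
have r0 : 0 < r.+1%:R :> R by rewrite ltr0n.
apply: (@le_trans _ _ (r.+1%:R^-1 * (2 * (- r.+1%:R * (l + 2 * e1))))).
  have -> : r.+1%:R^-1 * (2 * (- r.+1%:R * (l + 2 * e1))) =
      - 2 * (l + 2 * e1) by field; rewrite gt_eqF.
  by rewrite /l; lra.
by rewrite ler_pM2l ?invr_gt0// ler_pM2l.
Qed.

Lemma beta_continuous (R : realType) : continuous (@beta R).
Proof.
apply: torus_continuous.
pose b (t : R) := fine (beta (torus_pi t)).
have -> : @beta R \o @torus_pi R = EFin \o b.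
  by apply/funext => t /=; rewrite fineK// beta_fin_num.
suff cb : continuous b.
  by move=> t; apply: cvg_EFin; [exact: nearW|exact: cb].
move=> t; apply/cvgrPdist_le => e e0.
have [d d0 hd] := beta_uniform_lsc e0.
have hb s s' : `|s' - s| <= d -> b s <= b s' + e.
  by move=> /hd; rewrite -lee_fin EFinD !fineK ?beta_fin_num.
apply/nbhs_ballP; exists d => // s /ltW ts.
(* As [d] does not depend on the base point, [hb] applies with the two points exchanged. *)
have h1 := hb _ _ ts; rewrite distrC in ts; have h2 := hb _ _ ts.
by rewrite ler_norml; apply/andP; split; lra.
Qed.

Theorem theorem2p6 (R : realType) :
  continuous (@beta R) /\
  upper_semicontinuous (@alpha R) /\
  [set c : torus R | {for c, continuous (@alpha R)}] = @C_infty R.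
Proof.
split; first exact: beta_continuous.
split; first exact: alpha_usc.
by apply/seteqP; split => c /alpha_continuousP.
Qed.
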